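(* Let $\nu$ be a pm valuation on $K(\chi)$, $d$ be an immediate key degree, and let $(\Phi_i)$ be a sequence of key polynomials of degree $d$ such that the sequence $(\nu(\Phi_i))$ is increasing and cofinal in $\nu(\chi^d-K_{d-1}[\chi])$. Then: 1) The sequence $(\nu_{\Phi_i})$ converges to $\nu$ on $K_d[\chi]$ in the sense that for every $f\in K_d[\chi]$ the sequence $(\nu_{\Phi_i}(f))$ is eventually equal to $\nu(f)$. 2) Let $d'$ be the smallest degree (if any) such that there exists a monic polynomial $\Phi'$ of degree $d'$ satisfying $\nu_{\Phi_i}(\Phi')<\nu(\Phi')$ for every $i$. Then $\Phi'$ is a key polynomial and $d'$ is the next key degree (the smallest key degree greater than $d$). 3) With $d'$ as in 2), the extension $(K_{d'-1}[\chi]|K_{d-1}[\chi],\nu)$ is immediate.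
   Context: $K$ is a field, $\chi\notin K$ is algebraic or transcendental over $K$; $[K[\chi]:K]=\infty$ if $\chi$ is transcendental. When $\chi$ is algebraic, elements of $K[\chi]$ are written uniquely as polynomials in $\chi$ of degree $<[K[\chi]:K]$ (all degrees considered are $<[K[\chi]:K]$). $K_m[\chi]$ is the $K$-module of polynomials of degree at most $m$. A $K$-module valuation is a map $\nu$ to $\Gamma\cup\{\infty\}$, $\Gamma$ a linearly ordered abelian group, such that $\nu(y)=\infty\Leftrightarrow y=0$, $\nu(y_1+y_2)\ge\min(\nu(y_1),\nu(y_2))$ and $\nu(xy)=\nu(x)+\nu(y)$ for $x\in K$. It is a pm (partially multiplicative) valuation if $\nu(fg)=\nu(f)+\nu(g)$ for all $f,g\in K[\chi]$ with $\deg(f)+\deg(g)<[K[\chi]:K]$; if $\chi$ is transcendental one requires moreover that $\nu$ is a field valuation on $K(\chi)$. It is assumed that $\nu K$ has finite rank. For a set $S$, $\nu S=\{\nu(s):s\in S\}\setminus\{\infty\}$, and $\nu(l-M)=\{\nu(l-x):x\in M\}\setminus\{\infty\}$. It is assumed that $\nu M$ has no greatest element for the $K$-modules $M$ considered (true if $\nu K$ is non-trivial). An element $l$ is pseudo-limit over $(M,\nu)$ if $\nu(l-M)\subseteq\nu M$ and $\nu(l-M)$ has no maximal element; for $K$-modules $M\subseteq N$, $(N|M,\nu)$ is immediate if every element of $N$ is pseudo-limit over $(M,\nu)$. For $\Phi$ monic of degree $d$, $1\le d<[K[\chi]:K]$, and $f,g\in K_{d-1}[\chi]$, $q_\Phi(f,g)$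 and $r_\Phi(f,g)$ are the quotient and remainder of the euclidean division of $fg$ by $\Phi$. $\Phi$ is a key polynomial for $\nu$ if $\nu(fg)=\nu(r_\Phi(f,g))<\nu(q_\Phi(f,g)\Phi)$ for all nonzero $f,g\in K_{d-1}[\chi]$ with $\deg(f)+\deg(g)<[K[\chi]:K]$. $d$ is a key degree if there is a key polynomial of degree $d$; it is immediate if moreover $\nu(\chi^d-K_{d-1}[\chi])$ has no maximal element. For $\Phi$ monic of degree $d$ and $f=f_0+f_1\Phi+\cdots+f_m\Phi^m$ with $f_i\in K_{d-1}[\chi]$, $\deg(f_m)+dm<[K[\chi]:K]$, set $\nu_\Phi(f):=\min_{0\le i\le m}(\nu(f_i)+i\nu(\Phi))$. *)

(* Defs.v *)
From mathcomp Require Import all_boot all_order all_algebra.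
From mathcomp Require Import boolp classical_sets cardinality.

Set Implicit Arguments.
Unset Strict Implicit.
Unset Printing Implicit Defensive.

Import Order.TTheory GRing.Theory.

Local Open Scope classical_set_scope.
Local Open Scope ring_scope.

(* G is a linearly ordered abelian group. [porderZmodType] is a mere join of a
   group structure and an order, without any compatibility axiom. *)
Definition linearly_ordered_group (G : porderZmodType) : Prop :=
  total (<=%R : rel G) /\ forall z x y : G, x <= y -> x + z <= y + z.

(* The value monoid G \cup {oo} is [option G], with oo encoded as [None]. *)
Section ValueMonoid.
Context {G : porderZmodType}.
Implicit Types u v : option G.

Definition vle u v : bool :=
  match u, v with
  | _, None => true
  | None, Some _ => false
  | Some a, Some b => a <= b
  end.

Definition vlt u v : bool := (u != v) && vle u v.

Definition vmin u v := if vle u v then u else v.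

Definition vadd u v :=
  match u, v with
  | Some a, Some b => Some (a + b)
  | _, _ => None
  end.

Definition vmuln (i : nat) u := iter i (vadd u) (Some 0).

Definition no_greatest (S : set G) : Prop :=
  ~ exists2 a, S a & forall b, S b -> b <= a.

Definition convex_subgroup (V H : set G) : Prop :=
  [/\ H `<=` V, H 0,
      forall a b, H a -> H b -> H (a - b)
    & forall a b, H a -> V b -> 0 <= b <= a -> H b].

(* The rank of V is the number of its proper convex subgroups. *)
Definition finite_rank (V : set G) : Prop :=
  finite_set [set H | convex_subgroup V H].

End ValueMonoid.

Definition degree {K : fieldType} (f : {poly K}) : nat := (size f).-1.

(* The ambient field L plays the role of K(chi), K being embedded in L by
   iota; elements of K[chi] are handled through polynomials f : {poly K} and
   their values [peval iota chi f]. *)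
Section Extension.
Context {K L : fieldType} (iota : {rmorphism K -> L}) (chi : L).

Definition peval (f : {poly K}) : L := (map_poly iota f).[chi].

(* L = K(chi) *)
Definition generated_by : Prop :=
  forall z : L, exists f g : {poly K}, peval g != 0 /\ z = peval f / peval g.

(* n < [K[chi] : K], the right-hand side being possibly infinite: K[chi]
   contains n + 1 elements that are linearly independent over K. *)
Definition lt_ext_degree (n : nat) : Prop :=
  exists v : 'I_n.+1 -> {poly K}, forall c : 'I_n.+1 -> K,
    \sum_i iota (c i) * peval (v i) = 0 -> forall i, c i = 0.

(* K_m[chi] *)
Definition Kpoly (m : nat) : set L :=
  [set peval f | f in [set f : {poly K} | (size f <= m.+1)%N]].

End Extension.

Section Valuation.
Context {K L : fieldType} (iota : {rmorphism K -> L}) (chi : L).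
Context {G : porderZmodType} (nu : L -> option G).

Local Notation ev := (peval iota chi).

Record module_valuation : Prop := ModuleValuation {
  mval_eq0 : forall y, nu y = None <-> y = 0;
  mval_add : forall y1 y2, vle (vmin (nu y1) (nu y2)) (nu (y1 + y2));
  mval_scale : forall (x : K) y, nu (iota x * y) = vadd (nu (iota x)) (nu y)
}.

Record field_valuation : Prop := FieldValuation {
  fval_eq0 : forall y, nu y = None <-> y = 0;
  fval_add : forall y1 y2, vle (vmin (nu y1) (nu y2)) (nu (y1 + y2));
  fval_mul : forall y1 y2, nu (y1 * y2) = vadd (nu y1) (nu y2)
}.

Record pm_valuation : Prop := PmValuation {
  pmval_module : module_valuation;
  pmval_mul : forall f g : {poly K},
    lt_ext_degree iota chi (degree f + degree g) ->
    nu (ev f * ev g) = vadd (nu (ev f)) (nu (ev g));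
  pmval_field : ~ algebraicOver iota chi -> field_valuation
}.

(* nu S, without oo *)
Definition values (S : set L) : set G :=
  [set a | exists2 s, S s & nu s = Some a].

(* nu (l - M), without oo *)
Definition dist_values (l : L) (M : set L) : set G :=
  values [set l - x | x in M].

Definition pseudo_limit (M : set L) (l : L) : Prop :=
  dist_values l M `<=` values M /\ no_greatest (dist_values l M).

Definition immediate_ext (N M : set L) : Prop :=
  M `<=` N /\ forall l, N l -> pseudo_limit M l.

(* For nonzero f and g, f, g \in K_{d-1}[chi] with d = deg Phi means that
   their degrees are less than that of Phi. *)
Definition key_polynomial (Phi : {poly K}) : Prop :=
  [/\ Phi \is monic, (1 <= degree Phi)%N, lt_ext_degree iota chi (degree Phi)
    & forall f g : {poly K}, f != 0 -> g != 0 ->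
        (degree f < degree Phi)%N -> (degree g < degree Phi)%N ->
        lt_ext_degree iota chi (degree f + degree g) ->
        let q := (f * g) %/ Phi in
        let r := (f * g) %% Phi in
        nu (ev f * ev g) = nu (ev r) /\ vlt (nu (ev r)) (nu (ev q * ev Phi))].

Definition key_degree (d : nat) : Prop :=
  exists2 Phi, key_polynomial Phi & degree Phi = d.

Definition immediate_key_degree (d : nat) : Prop :=
  key_degree d /\ no_greatest (dist_values (chi ^+ d) (Kpoly iota chi d.-1)).

Definition next_key_degree (d e : nat) : Prop :=
  [/\ key_degree e, (d < e)%N
    & forall e', key_degree e' -> (d < e')%N -> (e <= e')%N].

(* i-th coefficient f_i of the expansion f = f_0 + f_1 Phi + f_2 Phi^2 + ...
   with deg f_i < deg Phi *)
Definition adic_coef (Phi f : {poly K}) (i : nat) : {poly K} :=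
  (f %/ Phi ^+ i) %% Phi.

(* nu_Phi (f); since f_i = 0 for i >= size f, and more generally beyond the
   last index m of the expansion of f, the extra terms are all oo. *)
Definition nu_trunc (Phi f : {poly K}) : option G :=
  \big[vmin/None]_(i < size f)
    vadd (nu (ev (adic_coef Phi f i))) (vmuln i (nu (ev Phi))).

Definition sub_nu_limit (Phi : nat -> {poly K}) (Phi' : {poly K}) : Prop :=
  [/\ Phi' \is monic, lt_ext_degree iota chi (degree Phi')
    & forall i, vlt (nu_trunc (Phi i) Phi') (nu (ev Phi'))].

Definition least_limit_degree (Phi : nat -> {poly K}) (d' : nat) : Prop :=
  (exists2 Phi', sub_nu_limit Phi Phi' & degree Phi' = d') /\
  forall Phi', sub_nu_limit Phi Phi' -> (d' <= degree Phi')%N.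

End Valuation.

Lemma adic_expansion (K : fieldType) (Phi f : {poly K}) : (1 < size Phi)%N ->
  f = \sum_(i < size f) adic_coef Phi f i * Phi ^+ i.
Proof.
move=> sPhi.
have E n : f = \sum_(i < n) adic_coef Phi f i * Phi ^+ i
                 + (f %/ Phi ^+ n) * Phi ^+ n.
  elim: n => [|n IHn]; first by rewrite big_ord0 add0r expr0 mulr1 divp1.
  rewrite big_ord_recr /= {1}IHn -addrA; congr (_ + _).
  rewrite /adic_coef {1}(divp_eq (f %/ Phi ^+ n) Phi) mulrDl addrC.
  by rewrite divp_divl -mulrA -exprSr -exprS.
rewrite [LHS](E (size f)) divp_small ?mul0r ?addr0 //.
have [->|f0] := eqVneq f 0.
  by rewrite size_poly0 expr0 size_poly1.
have P0 : Phi ^+ size f != 0.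
  by rewrite expf_neq0 // -size_poly_gt0 (ltn_trans _ sPhi).
rewrite -(prednK (_ : 0 < size (Phi ^+ size f))%N) ?size_poly_gt0 //.
by rewrite ltnS size_exp leq_pmull // -ltnS prednK // (ltn_trans _ sPhi).
Qed.

(* Main.v *)
(* Call f dominant for Phi_j if all the terms f_k Phi_j^k with k > 0 of its
   Phi_j-adic expansion have value > nu(f); then nu(f) = nu(f_0) = nu_Phi_j(f).
   Dominant elements are stable under products, and rewriting the Phi_i-adic
   expansion of f in terms of Phi_j, where nu(Phi_j) > nu(Phi_i), shows that f
   is dominant for all large j as soon as nu_Phi_i(f) = nu(f) for some i. By
   minimality of d' this applies to all f of degree < d'. The immediacy of the
   extension follows by subtracting f_0 from f = l - x, and the key property of
   Phi' by comparing one term of q Phi' = f g - r on both sides. *)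

Require Import Defs.
From mathcomp Require Import all_boot all_order all_algebra.
From mathcomp Require Import boolp classical_sets cardinality.
From mathcomp Require Import zify.

Set Implicit Arguments.
Unset Strict Implicit.
Unset Printing Implicit Defensive.

Import Order.TTheory GRing.Theory.

Local Open Scope classical_set_scope.
Local Open Scope ring_scope.

(** * Weak and strict lower bounds in an ordered group with infinity *)

Section Above.
Context (G : porderZmodType) (Gord : linearly_ordered_group G).
Implicit Types (v w : G) (u x : option G) (s t : bool).

Lemma og_lerD2r (c a b : G) : (a + c <= b + c) = (a <= b).
Proof. by apply/idP/idP => [/(Gord.2 (- c))|/(Gord.2 c)//]; rewrite !addrK. Qed.

Lemma og_ltrD2r (c a b : G) : (a + c < b + c) = (a < b).
Proof. by rewrite !lt_neqAle og_lerD2r (inj_eq (addIr c)). Qed.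

Lemma og_ltNge (a b : G) : ~~ (a <= b) -> b < a.
Proof.
move=> nab; case/orP: (Gord.1 a b) => [ab|ba]; first by rewrite ab in nab.
by rewrite lt_neqAle ba andbT; apply: contraNneq nab => ->.
Qed.

(** The flag [s] selects the strict or the weak bound, so that both travel through the same lemmas.
    Infinity satisfies every bound, which covers vanishing digits. *)
Definition above s v u :=
  if u is Some a then if s then v < a else v <= a else true.

Lemma above_weak s t v w u :
  (t -> s) -> w <= v -> above s v u -> above t w u.
Proof.
case: u => //= a; case: s t => [] [] //= st wv.
- exact: le_lt_trans.
- by move/ltW; apply: le_trans.
- by have := st isT.
- exact: le_trans.
Qed.

Lemma above_lt s t v w u : w < v -> above s v u -> above t w u.
Proof.
case: u => //= a wv sv; have va : v <= a by case: s sv => // /ltW.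
by have wa := lt_le_trans wv va; case: t => //; apply: ltW.
Qed.

Lemma above_vadd s t v w u x :
  above s v u -> above t w x -> above (s || t) (v + w) (vadd u x).
Proof.
case: u => [a|] //; case: x => [b|] //=.
have D (p q r : G) : (r + p <= r + q) = (p <= q).
  by rewrite ![r + _]addrC og_lerD2r.
have D' (p q r : G) : (r + p < r + q) = (p < q).
  by rewrite ![r + _]addrC og_ltrD2r.
case: s t => [] [] /= va wb.
- by apply: (lt_trans (y := a + w)); rewrite ?og_ltrD2r ?D'.
- by apply: (lt_le_trans (y := a + w)); rewrite ?og_ltrD2r ?D.
- by apply: (le_lt_trans (y := a + w)); rewrite ?og_lerD2r ?D'.
- by apply: (le_trans (y := a + w)); rewrite ?og_lerD2r ?D.
Qed.

Lemma vlt_above v u : vlt (Some v) u = above true v u.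
Proof.
case: u => //= a; rewrite /vlt /= lt_neqAle; congr (~~ _ && _).
Qed.

Lemma above_anti v u : above false v u -> ~~ above true v u -> u = Some v.
Proof. by case: u => //= a; rewrite le_eqVlt => /orP[/eqP->|->]. Qed.

Lemma above_total v u : ~~ above false v u -> vlt u (Some v).
Proof.
case: u => //= a /og_ltNge av; rewrite /vlt /= (ltW av) andbT.
by apply: contraTneq av => -[->]; rewrite ltxx.
Qed.

Lemma above_vmin s v u x :
  above s v (vmin u x) = above s v u && above s v x.
Proof.
rewrite /vmin; case: u x => [a|] [b|] //=; rewrite ?andbT //.
have [ab|/og_ltNge ba] := boolP (a <= b) => /=.
  case: s; apply/idP/andP => [h|[]//]; split=> //.
    exact: lt_le_trans ab.
  exact: le_trans ab.
case: s; apply/idP/andP => [h|[]//]; split=> //.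
  exact: lt_trans ba.
exact: le_trans (ltW ba).
Qed.

Lemma above_vle s v u x : vle u x -> above s v u -> above s v x.
Proof.
case: u x => [a|] [b|] //= ab; case: s => va.
  exact: lt_le_trans ab.
exact: le_trans ab.
Qed.

Lemma vmuln_Some k v : vmuln k (Some v) = Some (v *+ k).
Proof. by rewrite /vmuln; elim: k => //= k ->; rewrite mulrS. Qed.

(** A linear order excludes torsion: as [a + a = 0], adding [a] to one of [a <= 0], [0 <= a] turns
    it into the other. This serves to find the value of [-1]. *)
Lemma og_double_eq0 (a : G) : a + a = 0 -> a = 0.
Proof.
move=> a2; have nn : a = - a by apply/eqP; rewrite -subr_eq0 opprK a2.
case/orP: (Gord.1 a 0) => h.
  by apply/le_anti/andP; split=> //; rewrite -(og_lerD2r a) a2 add0r.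
by apply/le_anti/andP; split=> //; rewrite -(og_lerD2r a) a2 add0r.
Qed.

End Above.

(** * Degrees of polynomials and of the extension *)

Lemma lt_ext_degree_le (K L : fieldType) (iota : {rmorphism K -> L}) (chi : L)
    m n : (m <= n)%N -> lt_ext_degree iota chi n -> lt_ext_degree iota chi m.
Proof.
move=> mn [v hv]; have mn1 : (m.+1 <= n.+1)%N by [].
exists (v \o widen_ord mn1) => c hc i.
(* A relation among the first [m + 1] members is extended by zero coefficients to the whole
   independent family. *)
pose c' (j : 'I_n.+1) := if insub (val j) is Some k then c k else 0.
have <- : c' (widen_ord mn1 i) = c i by rewrite /c' /= valK.
apply: hv; rewrite -[RHS]hc (bigID (fun j : 'I_n.+1 => (j < m.+1)%N)) /=.
rewrite [X in _ + X]big1 ?addr0 => [|j jm].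
  rewrite (big_ord_narrow mn1) /=.
  by apply: eq_bigr => j _; rewrite /c' /= valK.
by rewrite /c' insubF ?rmorph0 ?mul0r //; apply/negbTE.
Qed.

Lemma degree_ltn (K : fieldType) (f g : {poly K}) :
  (0 < degree g)%N -> (size f < size g)%N -> (degree f < degree g)%N.
Proof. by rewrite /degree; move: (size f) (size g) => m n; lia. Qed.

Lemma degreeM (K : fieldType) (f g : {poly K}) : f != 0 -> g != 0 ->
  degree (f * g) = (degree f + degree g)%N.
Proof.
move=> f0 g0; rewrite /degree size_mul // -!subn1.
move: f0 g0; rewrite -!size_poly_gt0.
by case: (size f) (size g) => [|m] [|n] //; rewrite !subn1 /= addnS.
Qed.

(** * Evaluation of polynomials at [chi] *)

Section Peval.
Context {K L : fieldType} (iota : {rmorphism K -> L}) (chi : L).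
Local Notation ev := (peval iota chi).

Lemma pevalD f g : ev (f + g) = ev f + ev g.
Proof. by rewrite /peval rmorphD hornerD. Qed.

Lemma pevalM f g : ev (f * g) = ev f * ev g.
Proof. by rewrite /peval rmorphM hornerM. Qed.

Lemma pevalC c : ev c%:P = iota c.
Proof. by rewrite /peval map_polyC hornerC. Qed.

Lemma pevalZ c f : ev (c *: f) = iota c * ev f.
Proof. by rewrite -mul_polyC pevalM pevalC. Qed.

Lemma pevalN f : ev (- f) = - ev f.
Proof. by rewrite /peval rmorphN hornerN. Qed.

Lemma peval0 : ev 0 = 0.
Proof. by rewrite /peval rmorph0 horner0. Qed.

Lemma pevalXn n : ev 'X^n = chi ^+ n.
Proof. by rewrite /peval map_polyXn hornerXn. Qed.

(* If f of degree m vanished at chi, reducing n + 1 > m polynomials modulo f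
   would put their values in a space of dimension m. *)
Lemma peval_eq0 n f : lt_ext_degree iota chi n -> (degree f <= n)%N ->
  ev f = 0 -> f = 0.
Proof.
move=> [v hv] fn f0; apply/eqP/contraT => fN0.
set m := (size f).-1.
have vr i : ev (v i) = ev (v i %% f).
  by rewrite {1}(divp_eq (v i) f) pevalD pevalM f0 mulr0 add0r.
have sr i : (size (v i %% f)%R <= m)%N.
  by rewrite -ltnS prednK ?size_poly_gt0 // ltn_modp.
(* The [n + 1] remainders have coefficients in only [m <= n] columns, so a nonzero row vector kills
   [A] and yields a forbidden relation. *)
pose A : 'M[K]_(n.+1, m) := \matrix_(i, j) (v i %% f)`_j.
have : kermx A != 0.
  rewrite kermx_eq0 /row_free; apply: contraTneq (rank_leq_col A) => ->.
  by rewrite -ltnNge ltnS.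
case/rowV0Pn => c /sub_kermxP cA cN0; case/negP: cN0.
apply/eqP/rowP => i; rewrite mxE; apply: (hv (fun i => c 0 i)).
rewrite (eq_bigr (fun i => ev (c 0 i *: (v i %% f)))); last first.
  by move=> j _; rewrite pevalZ vr.
rewrite -(big_morph ev pevalD peval0) (_ : \sum_(i < _) _ = 0) ?peval0 //.
apply/polyP => j; rewrite coef_sum coef0.
have [jm|mj] := ltnP j m; last first.
  by apply: big1 => k _; rewrite coefZ nth_default ?mulr0 // (leq_trans (sr k)).
have := congr1 (fun B : 'rV_m => B 0 (Ordinal jm)) cA; rewrite !mxE => E.
by rewrite -[RHS]E; apply: eq_bigr => k _; rewrite coefZ mxE.
Qed.

End Peval.

(** * Bounds on the terms of an adic expansion *)

Section Filtration.
Context {K L : fieldType} (iota : {rmorphism K -> L}) (chi : L).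
Context (G : porderZmodType) (nu : L -> option G) (Phi : {poly K}).

Definition term (f : {poly K}) k : option G :=
  vadd (nu (peval iota chi (adic_coef Phi f k)))
       (vmuln k (nu (peval iota chi Phi))).

(* A lower bound v on all the terms of the Phi-adic expansion, which is strict
   for the indices marked by s. *)
Definition filt (s : nat -> bool) (v : G) (f : {poly K}) : Prop :=
  forall k, above (s k) v (term f k).

(** At index 0 only the weak bound is asked; that the constant digit has exactly the value of [f]
    then follows, see [dominant_modp]. The condition is vacuous if [f] vanishes at [chi]. *)
Definition dominant (f : {poly K}) : Prop :=
  forall v, nu (peval iota chi f) = Some v -> filt (fun k => 0 < k)%N v f.

End Filtration.

(** * Ultrametric properties of a pm valuation *)

Section PmValuation.
Context {K L : fieldType} (iota : {rmorphism K -> L}) (chi : L).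
Context (G : porderZmodType) (Gord : linearly_ordered_group G).
Context (nu : L -> option G) (pm : pm_valuation iota chi nu).
Local Notation ev := (peval iota chi).
Local Notation ltD := (lt_ext_degree iota chi).
Implicit Types (f g a b : {poly K}) (v : G).

Let mv := pmval_module pm.



Lemma nu0 : nu 0 = None.
Proof. by apply/(mval_eq0 mv). Qed.

Lemma above_nuD s v x y :
  above s v (nu x) -> above s v (nu y) -> above s v (nu (x + y)).
Proof.
move=> hx hy; apply: above_vle (mval_add mv x y) _.
by rewrite above_vmin // hx hy.
Qed.

Lemma nu_iota c : c != 0 -> exists v, nu (iota c) = Some v.
Proof.
move=> c0; case e: (nu (iota c)) => [v|]; first by exists v.
by move/(mval_eq0 mv)/eqP: e; rewrite fmorph_eq0 (negPf c0).
Qed.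

Lemma nu1 : nu 1 = Some 0.
Proof.
have [v hv] := nu_iota (oner_neq0 K); rewrite rmorph1 in hv.
have := mval_scale mv 1 1; rewrite rmorph1 mulr1 hv /= => -[].
by move/(congr1 (fun x => x - v)); rewrite subrr addrK => <-.
Qed.

(** Since [-1] squares to [1], its value doubles to 0 and is therefore 0. *)
Lemma nuN x : nu (- x) = nu x.
Proof.
have h0 : (-1 : K) != 0 by rewrite oppr_eq0 oner_eq0.
have [v hv] := nu_iota h0.
have := mval_scale mv (-1) (iota (-1)).
rewrite -rmorphM mulrNN mulr1 rmorph1 nu1 hv /= => -[].
move=> /esym/(og_double_eq0 Gord) v0.
have := mval_scale mv (-1) x; rewrite hv v0 rmorphN1 mulN1r => ->.
by case: (nu x) => //= a; rewrite add0r.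
Qed.

Lemma above_nuB s v x y :
  above s v (nu x) -> above s v (nu y) -> above s v (nu (x - y)).
Proof. by move=> hx hy; apply: above_nuD; rewrite ?nuN. Qed.

Lemma nuD_eq v x y :
  nu x = Some v -> above true v (nu y) -> nu (x + y) = Some v.
Proof.
move=> hx hy; apply: above_anti.
  by apply: above_nuD; [rewrite hx /= | exact: above_weak hy].
apply/negP => h; have := above_nuB h hy.
by rewrite addrK hx /= ltxx.
Qed.

Lemma nu_peval_Some n f : ltD n -> (degree f <= n)%N -> f != 0 ->
  exists v, nu (ev f) = Some v.
Proof.
move=> hn fn f0; case e: (nu (ev f)) => [v|]; first by exists v.
by move/(mval_eq0 mv)/(peval_eq0 hn fn)/eqP: e; rewrite (negPf f0).
Qed.

(** * Expansions along a single key polynomial *)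

Section KeyPolynomial.
Context (Phi : {poly K}) (key : key_polynomial iota chi nu Phi).
Let Phi_monic : Phi \is monic. Proof. by case: key. Qed.
Let Phi0 : Phi != 0 := monic_neq0 Phi_monic.
Let sPhi : (1 < size Phi)%N.
Proof. by case: key => _; rewrite /degree; case: size => [|[]]. Qed.
Let degPhi : size Phi = (degree Phi).+1.
Proof. by rewrite /degree prednK // ltnW. Qed.

Let lt_deg (c : {poly K}) :
  (size c < size Phi)%N -> (degree c < degree Phi)%N.
Proof. by apply: degree_ltn; case: key. Qed.

(** The default 0 is never taken: the degree of [Phi] is below that of the extension, so [Phi] does
    not vanish at [chi]. *)
Let p := odflt 0 (nu (ev Phi)).
Let nuPhi : nu (ev Phi) = Some p.
Proof.
case: key => _ _ hd _; rewrite /p.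
by have [v ->] := nu_peval_Some hd (leqnn _) Phi0.
Qed.
Let nuPhiX k : vmuln k (nu (ev Phi)) = Some (p *+ k).
Proof. by rewrite nuPhi vmuln_Some. Qed.

Local Notation term := (term iota chi nu Phi).
Local Notation filt := (filt iota chi nu Phi).

Lemma adic_coefD f g k :
  adic_coef Phi (f + g) k = adic_coef Phi f k + adic_coef Phi g k.
Proof. by rewrite /adic_coef divpD modpD. Qed.

Lemma adic_coefZ c f k : adic_coef Phi (c *: f) k = c *: adic_coef Phi f k.
Proof. by rewrite /adic_coef divpZl modpZl. Qed.

Lemma adic_coefN f k : adic_coef Phi (- f) k = - adic_coef Phi f k.
Proof. by rewrite -!scaleN1r adic_coefZ. Qed.

Lemma adic_coef_mono a n k : (size a < size Phi)%N ->
  adic_coef Phi (a * Phi ^+ n) k = if k == n then a else 0.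
Proof.
move=> sa; have PN0 i : Phi ^+ i != 0 by rewrite expf_neq0.
rewrite /adic_coef; case: ltngtP => [kn|nk|->].
- rewrite -(subnK (ltnW kn)) exprD mulrA mulpK //.
  by rewrite -(prednK (_ : 0 < n - k)%N) ?subn_gt0 // exprSr mulrA modp_mull.
- rewrite -(subnK (ltnW nk)) exprD divp_pmul2r // divp_small ?mod0p //.
  apply: leq_trans sa _.
  rewrite -(prednK (_ : 0 < k - n)%N) ?subn_gt0 // exprS.
  by rewrite dvdp_leq ?mulf_neq0 // dvdp_mulr.
- by rewrite mulpK // modp_small.
Qed.

Lemma size_adic_coef f k : (size (adic_coef Phi f k) < size Phi)%N.
Proof. by rewrite ltn_modp. Qed.

(** This keeps every term of the expansion within the degrees in which [nu] is multiplicative. *)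
Lemma degree_adic_coef f k : adic_coef Phi f k != 0 ->
  (degree (adic_coef Phi f k) + k * degree Phi <= degree f)%N.
Proof.
rewrite /adic_coef => c0; set q := f %/ Phi ^+ k.
have q0 : q != 0 by apply: contraNneq c0; rewrite -/q => ->; rewrite mod0p.
have P0 : Phi ^+ k != 0 by rewrite expf_neq0.
have sq : (0 < size f - (size (Phi ^+ k)).-1)%N.
  by rewrite -size_divp // size_poly_gt0.
have -> : (k * degree Phi)%N = (size (Phi ^+ k)).-1.
  by rewrite size_exp /= mulnC.
apply: (@leq_trans (degree q + (size (Phi ^+ k)).-1)).
  by rewrite leq_add2r /degree -!subn1 leq_sub2r // leq_modp.
rewrite /degree /q size_divp //; move: sq; rewrite subn_gt0.
move: (size f) (_.-1) => [|x] // y; rewrite ltnS => yx.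
by rewrite subSn //= subnK.
Qed.

Lemma adic_coef_big f k : (size f <= k)%N -> adic_coef Phi f k = 0.
Proof.
move=> fk; have [->|f0] := eqVneq f 0; first by rewrite /adic_coef div0p mod0p.
apply/eqP/contraT => /degree_adic_coef.
have dP : (0 < degree Phi)%N by rewrite -ltnS -degPhi.
move=> /(leq_trans (leq_addl _ _)); rewrite leqNgt => /negP[].
apply: leq_trans (leq_pmulr k dP); apply: leq_trans fk.
by rewrite /degree prednK // size_poly_gt0.
Qed.

Lemma filt_weak (s t : nat -> bool) v w f :
  (forall k, t k -> s k) -> w <= v -> filt s v f -> filt t w f.
Proof. by move=> st wv hf k; apply: above_weak (hf k) => //; apply: st. Qed.

Lemma filt_lt (s t : nat -> bool) v w f : w < v -> filt s v f -> filt t w f.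
Proof. by move=> wv hf k; apply: above_lt (hf k). Qed.

(** The contribution of the power of [Phi] being finite, a bound on a term amounts to a bound on its
    digit, where the ultrametric inequality applies. *)
Lemma above_vaddr s v u (c : G) :
  above s v (vadd u (Some c)) = above s (v - c) u.
Proof.
case: u => //= a.
by case: s; rewrite -[v in LHS](subrK c) ?(og_ltrD2r Gord) ?(og_lerD2r Gord).
Qed.

Lemma filt0 s v : filt s v 0.
Proof. by move=> k; rewrite /term /adic_coef div0p mod0p peval0 nu0. Qed.

Lemma filtD s v f g : filt s v f -> filt s v g -> filt s v (f + g).
Proof.
move=> hf hg k; have := hf k; have := hg k.
rewrite /term nuPhiX !above_vaddr adic_coefD pevalD => h1 h2.
exact: above_nuD.
Qed.

Lemma filtN s v f : filt s v f -> filt s v (- f).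
Proof. by move=> hf k; rewrite /term adic_coefN pevalN nuN; apply: hf. Qed.

Lemma filt_sum s v (I : Type) (r : seq I) (P : pred I) (F : I -> {poly K}) :
  (forall i, P i -> filt s v (F i)) -> filt s v (\sum_(i <- r | P i) F i).
Proof.
by move=> h; apply: (big_ind (filt s v)) => //; [apply: filt0 | apply: filtD].
Qed.

Lemma filt_mono s v a n : (size a < size Phi)%N ->
  above (s n) v (vadd (nu (ev a)) (vmuln n (nu (ev Phi)))) ->
  filt s v (a * Phi ^+ n).
Proof.
move=> sa h k; rewrite /term adic_coef_mono //.
by case: eqP => [->//|_]; rewrite peval0 nu0.
Qed.

Lemma filt_small s v a : (size a < size Phi)%N ->
  above (s 0) v (nu (ev a)) -> filt s v a.
Proof.
move=> sa h; rewrite -[a]mulr1 -(expr0 Phi); apply: filt_mono => //.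
by move: h; case: (nu _) => //= c; rewrite addr0.
Qed.

(* Phi being a key polynomial means that the carry of the product
   of two digits has a strictly larger value than the product itself. *)
Lemma filt_mul_mono s v a b i j :
  (size a < size Phi)%N -> (size b < size Phi)%N -> ltD (degree a + degree b) ->
  above (s (i + j)%N) v (vadd (vadd (nu (ev a)) (vmuln i (nu (ev Phi))))
                       (vadd (nu (ev b)) (vmuln j (nu (ev Phi))))) ->
  filt s v (a * Phi ^+ i * (b * Phi ^+ j)).
Proof.
move=> sa sb hab h.
have [->|a0] := eqVneq a 0; first by rewrite !mul0r; apply: filt0.
have [->|b0] := eqVneq b 0; first by rewrite mul0r mulr0; apply: filt0.
case: key => _ _ _ /(_ a b a0 b0 (lt_deg sa) (lt_deg sb) hab) /=.
set q := _ %/ _; set r := _ %% _; case=> hr hq.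
have [va ea] := nu_peval_Some hab (leq_addr _ _) a0.
have [vb eb] := nu_peval_Some hab (leq_addl _ _) b0.
have ev_r : nu (ev r) = Some (va + vb) by rewrite -hr (pmval_mul pm) // ea eb.
rewrite ea eb !nuPhiX in h.
(* The remainder is the digit at index [i + j]; the quotient is carried to the next index. *)
have -> : a * Phi ^+ i * (b * Phi ^+ j) =
    r * Phi ^+ (i + j) + q * Phi ^+ (i + j).+1.
  rewrite mulrACA -exprD {1}(divp_eq (a * b) Phi) -/q -/r mulrDl addrC.
  by rewrite -mulrA -exprS.
have sum_eq : va + vb + p *+ (i + j) = va + p *+ i + (vb + p *+ j).
  by rewrite mulrnDr addrACA.
apply: filtD.
  apply: filt_mono; first by rewrite ltn_modp.
  by rewrite ev_r nuPhiX /= sum_eq.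
have [->|q0] := eqVneq q 0; first by rewrite mul0r; apply: filt0.
have degq : (degree q + degree Phi <= degree a + degree b)%N.
  rewrite -(degreeM q0 Phi0) -(degreeM a0 b0) /degree -!subn1.
  by rewrite leq_sub2r // leq_divMp.
(* Both factors have degree below that of [Phi], hence so does [q], which is thus a genuine
   digit. *)
have sq : (size q < size Phi)%N.
  have sq : size q = (degree q).+1 by rewrite /degree prednK // size_poly_gt0.
  by have := lt_deg sa; have := lt_deg sb; rewrite degPhi sq; lia.
apply: filt_mono => //.
have := hq; rewrite ev_r (pmval_mul pm); last exact: lt_ext_degree_le degq hab.
rewrite nuPhiX nuPhi vlt_above; case: (nu (ev q)) => //= w hw.
have {}hw : va + p *+ i + (vb + p *+ j) < w + p *+ (i + j).+1.
  by rewrite -sum_eq mulrS addrA og_ltrD2r.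
(* The carry lies strictly above the product, so it meets the bound whichever flag stands at its
   index. *)
case: (s _) h => /= h; case: (s _) => /=;
  do ?[exact: lt_trans hw | exact: le_lt_trans hw
      | exact: ltW (le_lt_trans h hw) | exact: ltW (lt_trans h hw)].
Qed.

Lemma degree_adic_coef_le f k : (degree (adic_coef Phi f k) <= degree f)%N.
Proof.
have [->|/degree_adic_coef] := eqVneq (adic_coef Phi f k) 0.
  by rewrite /degree size_poly0.
exact: leq_trans (leq_addr _ _).
Qed.

(** The flag of a pair of terms is read at [i + j], where their product lands; carries are
    controlled by [filt_mul_mono], so the pairs can be treated one by one. *)
Lemma filt_mul s v f g : ltD (degree f + degree g) ->
  (forall i j, above (s (i + j)%N) v (vadd (term f i) (term g j))) ->
  filt s v (f * g).
Proof.
move=> hfg h; rewrite (adic_expansion f sPhi) (adic_expansion g sPhi).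
rewrite big_distrlr /=; do 2?[apply: filt_sum => ? _].
apply: filt_mul_mono (size_adic_coef _ _) (size_adic_coef _ _) _ (h _ _).
by apply: lt_ext_degree_le hfg; rewrite leq_add ?degree_adic_coef_le.
Qed.

(** Multiplicativity holds only in bounded degree, so the factors [Phi] are adjoined one at a
    time. *)
Lemma nu_mono a k : ltD (degree a + k * degree Phi) ->
  nu (ev (a * Phi ^+ k)) = vadd (nu (ev a)) (vmuln k (nu (ev Phi))).
Proof.
elim: k => [|k IH] h.
  by rewrite mulr1; case: (nu _) => //= c; rewrite addr0.
have [a0|a0] := eqVneq a 0; first by rewrite a0 mul0r peval0 nu0.
have deg_eq : degree (a * Phi ^+ k) = (degree a + k * degree Phi)%N.
  by rewrite degreeM ?expf_neq0 // {2}/degree size_exp mulnC.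
rewrite exprSr mulrA pevalM (pmval_mul pm); last first.
  by rewrite deg_eq -addnA -mulSnr.
rewrite IH ?nuPhiX; last first.
  by apply: lt_ext_degree_le h; rewrite leq_add2l leq_mul2r leqnSn orbT.
by rewrite nuPhi; case: (nu _) => //= c; rewrite -addrA mulrSr.
Qed.

(** In essence this is nu_Phi <= nu: by [nu_mono] the summands of the expansion have the values of
    its terms, and the ultrametric inequality bounds their sum. *)
Lemma nu_filt s v f :
  ltD (degree f) -> filt (fun=> s) v f -> above s v (nu (ev f)).
Proof.
move=> hf h; rewrite (adic_expansion f sPhi).
apply: (big_ind (fun f => above s v (nu (ev f)))).
- by rewrite peval0 nu0.
- by move=> a b ha hb; rewrite pevalD; apply: above_nuD.
move=> i _; have [->|a0] := eqVneq (adic_coef Phi f i) 0.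
  by rewrite mul0r peval0 nu0.
rewrite nu_mono; first exact: h.
exact: lt_ext_degree_le (degree_adic_coef a0) hf.
Qed.


Lemma above_termD s v f g k : above s v (term f k) -> above s v (term g k) ->
  above s v (term (f + g) k).
Proof.
rewrite /term nuPhiX !above_vaddr adic_coefD pevalD => h1 h2.
exact: above_nuD.
Qed.

Lemma termN f k : term (- f) k = term f k.
Proof. by rewrite /term adic_coefN pevalN nuN. Qed.

Lemma termD_eq v f g k : term f k = Some v -> above true v (term g k) ->
  term (f + g) k = Some v.
Proof.
move=> hf hg; apply: above_anti.
  by apply: above_termD; [rewrite hf /= | apply: above_weak hg].
apply/negP => h; have := above_termD h (_ : above true v (term (- g) k)).
by rewrite termN addrK hf /= ltxx => /(_ hg).
Qed.

Lemma term0_small f : (size f < size Phi)%N -> term f 0 = nu (ev f).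
Proof.
move=> sf; rewrite /term -[f]mulr1 -(expr0 Phi) adic_coef_mono //= mulr1.
by case: (nu _) => //= c; rewrite addr0.
Qed.

Lemma termS_small f k : (size f < size Phi)%N -> (0 < k)%N -> term f k = None.
Proof.
move=> sf k0; rewrite /term -[f]mulr1 -(expr0 Phi) adic_coef_mono //.
by rewrite -[k == _]negbK -lt0n k0 peval0 nu0.
Qed.

Lemma term0 f : term f 0 = nu (ev (f %% Phi)).
Proof.
rewrite /term /adic_coef expr0 divp1.
by case: (nu _) => //= c; rewrite addr0.
Qed.

Lemma filtZ s v w c f : nu (iota c) = Some w -> filt s v f ->
  filt s (w + v) (c *: f).
Proof.
move=> hc hf k; rewrite /term adic_coefZ pevalZ (mval_scale mv) hc.
have := above_vadd Gord (lexx w : above false w (Some w)) (hf k).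
rewrite /term orFb; case: (nu (ev _)) => // a; rewrite nuPhiX /=.
by rewrite addrA.
Qed.

(** If [i + j] is positive, so is one of the two indices, and one strict bound makes the bound on
    the sum strict. This gives the stability of dominance under products. *)
Lemma filt_pos_mul v w f g : ltD (degree f + degree g) ->
  filt (fun k => 0 < k)%N v f -> filt (fun k => 0 < k)%N w g ->
  filt (fun k => 0 < k)%N (v + w) (f * g).
Proof.
move=> hfg hf hg; apply: filt_mul => // i j.
by rewrite addn_gt0; apply: above_vadd.
Qed.

(** Removing the constant digit makes the term at index 0, the only one with a weak bound,
    infinite. *)
Lemma filt_sub_modp v f : filt (fun k => 0 < k)%N v f ->
  filt (fun=> true) v (f - f %% Phi).
Proof.
have sr : (size (f %% Phi)%R < size Phi)%N by rewrite ltn_modp.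
move=> hf [|k].
  by rewrite term0 modpD modpN (modp_small sr) subrr peval0 nu0.
by apply: above_termD; rewrite ?termN ?(termS_small sr) //; apply: hf.
Qed.

Lemma dominant_sub v f : ltD (degree f) -> dominant iota chi nu Phi f ->
  nu (ev f) = Some v -> above true v (nu (ev (f - f %% Phi))).
Proof.
move=> hf df hv; apply: nu_filt (filt_sub_modp (df v hv)).
apply: lt_ext_degree_le hf.
by rewrite {1}(divp_eq f Phi) addrK /degree -!subn1 leq_sub2r // leq_divMp.
Qed.

Lemma dominant_modp f : ltD (degree f) -> dominant iota chi nu Phi f ->
  nu (ev (f %% Phi)) = nu (ev f).
Proof.
move=> hf df; case e: (nu (ev f)) => [v|]; last first.
  move/(mval_eq0 mv)/(peval_eq0 hf (leqnn _)): e => ->.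
  by rewrite mod0p peval0 nu0.
have -> : f %% Phi = f + - (f - f %% Phi) by rewrite opprB addrC subrK.
by rewrite pevalD pevalN; apply: nuD_eq; rewrite ?nuN //; apply: dominant_sub.
Qed.

(** The minimum stops at [size f], but the digits beyond vanish, so it controls the terms at all
    indices. *)
Lemma above_nu_trunc s v f :
  above s v (nu_trunc iota chi nu Phi f) <-> filt (fun=> s) v f.
Proof.
split=> [h k|h].
  have [fk|kf] := leqP (size f) k.
    by rewrite /term adic_coef_big // peval0 nu0.
  suff: forall i : 'I_(size f), above s v (term f i) by move/(_ (Ordinal kf)).
  move=> i; move: h; rewrite /nu_trunc.
  have: i \in index_enum 'I_(size f) by rewrite mem_index_enum.
  elim: (index_enum _) => // j l IH; rewrite inE big_cons above_vmin //.
  by case/orP=> [/eqP <-|/IH h'] /andP[//] _; exact: h'.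
apply: (big_ind (above s v)) => // [x y hx hy|i _]; last exact: h.
by rewrite above_vmin // hx.
Qed.

(** All terms are at least nu(f), and the constant one attains this value. *)
Lemma dominant_nu_trunc f : ltD (degree f) -> dominant iota chi nu Phi f ->
  nu_trunc iota chi nu Phi f = nu (ev f).
Proof.
move=> hf df; case e: (nu (ev f)) => [v|]; last first.
  move/(mval_eq0 mv)/(peval_eq0 hf (leqnn _)): e => ->.
  by rewrite /nu_trunc size_poly0 big_ord0.
apply: above_anti.
  by apply/above_nu_trunc; apply: filt_weak (df v e).
apply/negP => /above_nu_trunc /(_ 0); rewrite term0 dominant_modp // e /=.
by rewrite ltxx.
Qed.

(* By dominance of q, modulo terms of value > v + w the k-th digit of q f is
   the remainder of (q mod Phi) f_k, whose value is known exactly. *)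
Lemma term_mul_eq v w q f k : ltD (degree q + degree f) ->
  q != 0 -> dominant iota chi nu Phi q -> nu (ev q) = Some v ->
  filt (fun=> false) w f -> term f k = Some w -> term (q * f) k = Some (v + w).
Proof.
move=> hqf q0 dq hq hf fk.
have hqD : ltD (degree q) by apply: lt_ext_degree_le hqf; rewrite leq_addr.
set r := q %% Phi; set a := adic_coef Phi f k.
have sr : (size r < size Phi)%N by rewrite ltn_modp.
have nur : nu (ev r) = Some v by rewrite dominant_modp.
have rN0 : r != 0 by apply: contra_eq_neq nur => ->; rewrite peval0 nu0.
have aN0 : a != 0.
  by apply: contra_eq_neq fk => a0; rewrite /term -/a a0 peval0 nu0.
have degr : (degree r <= degree q)%N.
  by rewrite /degree -!subn1 leq_sub2r // leq_modp.
have dega : (degree a <= degree f)%N := degree_adic_coef_le f k.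
(* The first summand carries the exact term at index [k]; the other two have a larger term there. *)
have -> : q * f = r * a * Phi ^+ k + (r * (f - a * Phi ^+ k) + (q - r) * f).
  by rewrite mulrBr mulrBl mulrA addrA [r * a * _ + _]addrC subrK addrC subrK.
apply: termD_eq.
  have hra : ltD (degree r + degree a).
    by apply: lt_ext_degree_le hqf; apply: leq_add.
  have sa : (size a < size Phi)%N by apply: size_adic_coef.
  case: key => _ _ _ /(_ r a rN0 aN0 (lt_deg sr) (lt_deg sa) hra) /= [hr _].
  rewrite /term /adic_coef mulpK ?expf_neq0 // -hr (pmval_mul pm) // nur.
  move: fk; rewrite /term -/a; case: (nu (ev a)) => //= b; rewrite nuPhiX /=.
  by move=> [<-]; rewrite addrA.
suff h : filt (fun i => i == k) (v + w) (r * (f - a * Phi ^+ k) + (q - r) * f).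
  by have := h k; rewrite eqxx.
apply: filtD; apply: filt_mul.
- apply: lt_ext_degree_le hqf; apply: leq_add => //.
  apply: leq_trans (_ : (maxn (size f) (size (- (a * Phi ^+ k)))).-1 <= _)%N.
    by rewrite /degree -!subn1 leq_sub2r // size_polyD.
  rewrite size_polyN -subn1 leq_subLR geq_max.
  have -> : (1 + degree f)%N = (maxn 1 (size f)) by rewrite /degree; lia.
  rewrite leq_maxr /=; have := degree_adic_coef aN0; rewrite -/a.
  have := degreeM aN0 (expf_neq0 k Phi0); have := size_exp Phi k.
  rewrite /degree => e1 e2; rewrite mulnC -e1 -e2.
  by move: (size _) (size f) => x y; lia.
(* As [r] is a constant digit, only the [k]-th digit of the other factor matters for the strict
   bound, and it has been removed. *)
- case=> [|i] j; last by rewrite (termS_small sr).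
  rewrite term0_small // nur add0n.
  have pk : term (a * Phi ^+ k) j = if j == k then term f k else None.
    rewrite /term adic_coef_mono ?size_adic_coef //.
    by case: eqP => [->//|_]; rewrite peval0 nu0.
  have [->|jk] := eqVneq j k.
    suff -> : term (f - a * Phi ^+ k) k = None by [].
    rewrite /term adic_coefD adic_coefN adic_coef_mono ?size_adic_coef // eqxx.
    by rewrite subrr peval0 nu0.
  apply: (above_vadd Gord (s := false) (t := false)) => //=.
  by apply: above_termD => //; rewrite termN pk (negPf jk).
- apply: lt_ext_degree_le hqf; rewrite leq_add2r {1}(divp_eq q Phi) addrK.
  by rewrite /degree -!subn1 leq_sub2r // leq_divMp.
- move=> i j; apply: (above_weak (s := true) (v := v + w)) => //.
  apply: (above_vadd Gord (s := true) (t := false)); last exact: hf.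
  exact: filt_sub_modp (dq v hq) i.
Qed.

End KeyPolynomial.
End PmValuation.

(** * Sequences of key polynomials with cofinal values *)

Section KeySequence.
Context {K L : fieldType} (iota : {rmorphism K -> L}) (chi : L).
Context (G : porderZmodType) (Gord : linearly_ordered_group G).
Context (nu : L -> option G) (pm : pm_valuation iota chi nu).
Context (d : nat) (Phi : nat -> {poly K}).
Local Notation ev := (peval iota chi).
Local Notation ltD := (lt_ext_degree iota chi).
Local Notation dominant := (dominant iota chi nu).
Local Notation filt := (filt iota chi nu).
Local Notation nu_trunc := (nu_trunc iota chi nu).
Local Notation dists := (dist_values nu (chi ^+ d) (Kpoly iota chi d.-1)).

Context (dists_unbounded : no_greatest dists).
Context (Phi_key : forall i,
  key_polynomial iota chi nu (Phi i) /\ degree (Phi i) = d).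
Context (Phi_incr : forall i j, (i <= j)%N ->
  vle (nu (ev (Phi i))) (nu (ev (Phi j)))).
Context (Phi_cofinal : forall a, dists a ->
  exists i, vle (Some a) (nu (ev (Phi i)))).

Let key i : key_polynomial iota chi nu (Phi i).
Proof. by case: (Phi_key i). Qed.
Let degPhi i : degree (Phi i) = d. Proof. by case: (Phi_key i). Qed.
Let d_gt0 : (0 < d)%N. Proof. by case: (key 0) => _; rewrite degPhi. Qed.
Let szPhi i : size (Phi i) = d.+1.
Proof.
by move: d_gt0; rewrite -(degPhi i) /degree; case: (size (Phi i)).
Qed.
Let ltD_d : ltD d. Proof. by case: (key 0) => _ _; rewrite degPhi. Qed.

Lemma dists_monic f a : f \is monic -> degree f = d -> nu (ev f) = Some a ->
  dists a.
Proof.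
move=> fm fd fa; exists (ev f) => //; exists (ev ('X^d - f)); last first.
  by rewrite -(pevalXn iota) -pevalN -pevalD opprB addrCA subrr addr0.
exists ('X^d - f) => //=; rewrite prednK //; apply/leq_sizeP => j dj.
have sf : size f = d.+1.
  by rewrite -fd /degree prednK // size_poly_gt0 monic_neq0.
rewrite coefB coefXn; have [->|jd] := eqVneq j d.
  by move/monicP: fm; rewrite /lead_coef sf /= => ->; rewrite subrr.
by rewrite nth_default ?subrr // sf ltn_neqAle eq_sym jd.
Qed.

(** Some distance [b] exceeds [a], and by cofinality and monotonicity the values of the [Phi j]
    eventually reach [b]. *)
Lemma eventually_above a : dists a ->
  exists N, forall j, (N <= j)%N -> above true a (nu (ev (Phi j))).
Proof.
move=> ha; have [b hb ab] : exists2 b, dists b & a < b.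
  apply: contrapT => h; apply: dists_unbounded; exists a => // b hb.
  by apply: contrapT => /negP /(og_ltNge Gord) ab; apply: h; exists b.
have [N hN] := Phi_cofinal hb; exists N => j Nj.
apply: (above_lt (s := false) _ ab); apply: above_vle (Phi_incr Nj) _.
by apply: above_vle hN _ => /=.
Qed.

(** Below degree [d], [f] is its own constant digit. In degree [d], with leading coefficient c, the
    expansion is f = (f - c Phi_j) + c Phi_j, and nu(f / c) is a distance, hence eventually exceeded
    by nu(Phi_j). *)
Lemma eventually_dominant_le_d f : (degree f <= d)%N ->
  exists N, forall j, (N <= j)%N -> dominant (Phi j) f.
Proof.
move=> fd; have [sf|sf] := leqP (size f) d.
  exists 0 => j _ v hv; apply: (filt_small pm (key j)); first by rewrite szPhi.
  by rewrite hv /=.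
have f0 : f != 0 by rewrite -size_poly_gt0 (leq_ltn_trans _ sf).
have {}sf : size f = d.+1.
  by move: fd sf; rewrite /degree; case: size => //= n; lia.
set c := lead_coef f; have c0 : c != 0 by rewrite lead_coef_eq0.
have fE : f = c *: (c^-1 *: f) by rewrite scalerA mulfV // scale1r.
have [w hw] := nu_iota pm c0.
have degcf : degree (c^-1 *: f) = d.
  by rewrite /degree size_scale ?invr_eq0 // sf.
have ltf : ltD (degree (c^-1 *: f)) by rewrite degcf.
have cf0 : c^-1 *: f != 0 by rewrite scaler_eq0 invr_eq0 negb_or c0.
have [a ha] := nu_peval_Some pm ltf (leqnn _) cf0.
have [|N hN] := @eventually_above a.
  apply: (dists_monic _ degcf ha).
  by rewrite monicE lead_coefZ mulVf.
exists N => j /hN hj v.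
have -> : nu (ev f) = Some (w + a).
  by rewrite fE pevalZ (mval_scale (pmval_module pm)) hw ha.
move=> [<-]; have mon : Phi j \is monic by case: (key j).
have lead : above true (w + a) (nu (ev (c *: Phi j))).
  rewrite pevalZ (mval_scale (pmval_module pm)) hw.
  exact: (above_vadd Gord (lexx w : above false w (Some w)) hj).
rewrite -[f](subrK (c *: Phi j)); apply: filtD => //.
  apply: (filt_small pm (key j)).
    rewrite szPhi; apply/leq_sizeP => i di; rewrite coefB coefZ.
    have [->|idn] := eqVneq i d.
      move/monicP: mon; rewrite /lead_coef szPhi /= => ->.
      by rewrite mulr1 /c /lead_coef sf subrr.
    by rewrite !nth_default ?mulr0 ?subrr // ?sf ?szPhi ltn_neqAle eq_sym idn.
  rewrite pevalD pevalN /=.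
  apply: (above_nuB Gord pm); last exact: above_weak lead.
  by rewrite fE pevalZ (mval_scale (pmval_module pm)) hw ha /=.
rewrite -mul_polyC -[X in _ * X]expr1; apply: (filt_mono pm (key j)).
  by rewrite szPhi (leq_ltn_trans (size_polyC_leq1 _)).
move: lead; rewrite pevalC pevalZ (mval_scale (pmval_module pm)).
case: (nu (iota c)) => //= u; case: (nu (ev (Phi j))) => //= b.
by rewrite addr0.
Qed.

(* Phi_i = Phi_j + h with nu(h) = nu(Phi_i) < nu(Phi_j), so substituting this
   in the Phi_i-adic expansion only produces terms of larger value outside of
   the constant one. *)
Lemma eventually_dominant_filt i f : ltD (degree f) ->
  (forall v, nu (ev f) = Some v -> filt (Phi i) (fun=> false) v f) ->
  exists N, forall j, (N <= j)%N -> dominant (Phi j) f.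
Proof.
move=> hf hfi; have Phi0 : Phi i != 0 by rewrite -size_poly_gt0 szPhi.
have [N hN] := eventually_dominant_le_d (eq_leq (degPhi i)).
exists N => j /hN hj v /hfi {}hfi.
have [p hp] := nu_peval_Some pm ltD_d (eq_leq (degPhi i)) Phi0.
(* [Phi i] is dominant for [Phi j], and this pattern of bounds passes to its powers as long as their
   degree stays in range. *)
have powi k : ltD (k * d) ->
    filt (Phi j) (fun k => 0 < k)%N (p *+ k) (Phi i ^+ k).
  elim: k => [|k IH] kd.
    rewrite expr0; apply: (filt_small pm (key j)).
      by rewrite size_poly1 szPhi.
    by rewrite pevalC rmorph1 (nu1 pm) /= mulr0n.
  rewrite exprS mulrS; apply: filt_pos_mul => //.
  - by rewrite degPhi /degree size_exp -/(degree _) degPhi mulnC -mulSn.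
  - exact: hj.
  - by apply: IH; apply: lt_ext_degree_le kd; rewrite leq_mul2r leqnSn orbT.
rewrite (adic_expansion f (_ : 1 < size (Phi i))%N) ?szPhi //.
apply: filt_sum => // k _.
set a := adic_coef (Phi i) f k; have [->|a0] := eqVneq a 0.
  by rewrite mul0r; apply: filt0.
have degf : (degree a + k * d <= degree f)%N.
  by rewrite -(degPhi i); apply: (degree_adic_coef (key i)).
have hak : ltD (degree a + k * d) by apply: lt_ext_degree_le hf.
have [b hb] := nu_peval_Some pm hak (leq_addr _ _) a0.
have := hfi k; rewrite /term -/a hb hp vmuln_Some /= => vle_b.
(* It suffices to bound each rewritten term by its own value, which is at least [v]. *)
apply: (filt_weak (s := fun k => (0 < k)%N) (v := b + p *+ k)) => //.
apply: filt_pos_mul => //.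
- by rewrite [X in (_ + X)%N]/degree size_exp -/(degree _) degPhi mulnC.
- apply: (filt_small pm (key j)); last by rewrite hb /=.
  by rewrite szPhi -(szPhi i) (size_adic_coef (key i)).
- by apply: powi; apply: lt_ext_degree_le hak; rewrite leq_addl.
Qed.

Lemma nu_trunc_eventually_eq f : (degree f <= d)%N ->
  exists N, forall i, (N <= i)%N -> nu_trunc (Phi i) f = nu (ev f).
Proof.
move=> fd; have [N hN] := eventually_dominant_le_d fd; exists N => i /hN.
by apply: dominant_nu_trunc => //; apply: lt_ext_degree_le ltD_d.
Qed.

(** * The least limit degree *)

Section LeastLimit.
Context (d' : nat) (least : least_limit_degree iota chi nu Phi d').

Let ltD_d' : ltD d'.
Proof. by case: least => -[P [_ hP _] <-]. Qed.

(** In degree at most [d] the truncations eventually equal [nu], so they cannot all stay strictly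
    below it. *)
Lemma least_limit_degree_gt : (d < d')%N.
Proof.
case: least => -[P [_ _ hP] <-] _; rewrite ltnNge; apply/negP.
move=> /nu_trunc_eventually_eq[N /(_ N (leqnn N)) eqN].
by have := hP N; rewrite eqN /vlt eqxx.
Qed.

(** Limits are monic, so minimality of [d'] is applied to [f] divided by its leading coefficient:
    some truncation is not below the value of this quotient, and the resulting bounds scale back to
    [f]. *)
Lemma eventually_dominant f : (degree f < d')%N ->
  exists N, forall j, (N <= j)%N -> dominant (Phi j) f.
Proof.
move=> fd'; have [->|f0] := eqVneq f 0.
  by exists 0 => j _ v; rewrite peval0 (nu0 pm).
have hf : ltD (degree f) by apply: lt_ext_degree_le ltD_d'; apply: ltnW.
set c := lead_coef f; have c0 : c != 0 by rewrite lead_coef_eq0.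
have [w hw] := nu_iota pm c0.
have fE : f = c *: (c^-1 *: f) by rewrite scalerA mulfV // scale1r.
have degE : degree (c^-1 *: f) = degree f.
  by rewrite /degree size_scale ?invr_eq0.
have hcf : ltD (degree (c^-1 *: f)) by rewrite degE.
have cf0 : c^-1 *: f != 0 by rewrite scaler_eq0 invr_eq0 negb_or c0.
have [a ha] := nu_peval_Some pm hcf (leqnn _) cf0.
have [i hi] : exists i,
    ~ vlt (nu_trunc (Phi i) (c^-1 *: f)) (nu (ev (c^-1 *: f))).
  apply/existsNP => h.
  have lim : sub_nu_limit iota chi nu Phi (c^-1 *: f).
    by split=> //; rewrite monicE lead_coefZ mulVf.
  by have := least.2 _ lim; rewrite degE leqNgt fd'.
apply: (@eventually_dominant_filt i) => // v; rewrite {1}fE pevalZ.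
rewrite (mval_scale (pmval_module pm)) hw ha => -[<-]; rewrite fE.
apply: (filtZ Gord pm (key i)) => //; apply/(above_nu_trunc Gord pm (key i)).
by apply: contrapT => /negP /(above_total Gord); rewrite -ha.
Qed.

(* If f g = q Phi' + r did not satisfy nu(f g) < nu(q Phi'), then f g and r
   would have only terms > nu(q) + nu_Phi_j(Phi'), but q Phi' has a term equal
   to this value. *)
Lemma limit_key_polynomial Phi' : sub_nu_limit iota chi nu Phi Phi' ->
  degree Phi' = d' -> key_polynomial iota chi nu Phi'.
Proof.
move=> [mon hPhi' lim] degPhi'; split=> //.
  by rewrite degPhi' (leq_trans _ least_limit_degree_gt).
rewrite degPhi' => f g f0 g0 fd' gd' hfg q r.
have Phi'0 := monic_neq0 mon.
have fgE : f * g = q * Phi' + r := divp_eq _ _.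
have [vf ef] := nu_peval_Some pm hfg (leq_addr _ _) f0.
have [vg eg] := nu_peval_Some pm hfg (leq_addl _ _) g0.
have efg : nu (ev (f * g)) = Some (vf + vg).
  by rewrite pevalM (pmval_mul pm) // ef eg.
have [q0|q0] := eqVneq q 0.
  by rewrite -pevalM {1}fgE q0 mul0r add0r peval0 mul0r (nu0 pm) // -[r]add0r
     -(mul0r Phi') -q0 -fgE efg.
have degq : (degree q + d' <= degree f + degree g)%N.
  rewrite -degPhi' -(degreeM q0 Phi'0) -(degreeM f0 g0).
  by rewrite /degree -!subn1 leq_sub2r // leq_divMp.
have hq : ltD (degree q + d') by apply: lt_ext_degree_le hfg.
(* Both factors have degree below [d'], hence so does [q], which is therefore eventually dominant
   too. *)
have qd' : (degree q < d')%N by lia.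
have rd' : (degree r < d')%N.
  rewrite -degPhi'; apply: degree_ltn; last by rewrite ltn_modp.
  by rewrite degPhi'; apply: leq_trans fd'.
have [Nf hNf] := eventually_dominant fd'.
have [Ng hNg] := eventually_dominant gd'.
have [Nq hNq] := eventually_dominant qd'.
have [Nr hNr] := eventually_dominant rd'.
pose j := (Nf + Ng + Nq + Nr)%N.
have {}hNf := hNf j ltac:(lia).
have {}hNg := hNg j ltac:(lia).
have {}hNq := hNq j ltac:(lia).
have {}hNr := hNr j ltac:(lia).
have [vq eq] := nu_peval_Some pm hq (leq_addr _ _) q0.
have [c ec] := nu_peval_Some pm hPhi' (leqnn _) Phi'0.
have eqPhi' : nu (ev q * ev Phi') = Some (vq + c).
  by rewrite (pmval_mul pm) ?degPhi' // eq ec.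
have [w ew wc] : exists2 w, nu_trunc (Phi j) Phi' = Some w & w < c.
  have := lim j; rewrite ec; case: (nu_trunc _ _) => // w.
  by rewrite (vlt_above w (Some c)) => wc; exists w.
have filtw : filt (Phi j) (fun=> false) w Phi'.
  by apply/(above_nu_trunc Gord pm (key j)); rewrite ew /=.
(* The minimum [w] is attained: otherwise all terms, hence their minimum, would exceed [w]. *)
have [k ek] : exists k, term iota chi nu (Phi j) Phi' k = Some w.
  apply: contrapT => h.
  have /(above_nu_trunc Gord pm (key j)) : filt (Phi j) (fun=> true) w Phi'.
    move=> k; apply: contrapT => /negP nk; apply: h; exists k.
    exact: above_anti (filtw k) nk.
  by rewrite ew /= ltxx.
have term_qPhi' : term iota chi nu (Phi j) (q * Phi') k = Some (vq + w).
  by apply: term_mul_eq => //; rewrite degPhi'.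
have ltvq : vq + w < vq + c by rewrite ![vq + _]addrC og_ltrD2r.
have fg_lt : vf + vg < vq + c.
  apply: (og_ltNge Gord); apply/negP => le_fg.
  have filt_fg : filt (Phi j) (fun=> true) (vq + w) (f * g).
    apply: (filt_lt (s := fun k => (0 < k)%N) _ (v := vf + vg)).
      exact: lt_le_trans ltvq le_fg.
    by apply: filt_pos_mul => //; [apply: hNf | apply: hNg].
  have rE : r = f * g - q * Phi' by rewrite fgE addrC addKr.
  have filt_r : filt (Phi j) (fun=> true) (vq + w) r.
    (* An infinite value forces [r] to be 0; a finite one is at least [vq + c], as this bounds both
       [f * g] and [q * Phi']. *)
    case er : (nu (ev r)) => [vr|]; last first.
      have hr : ltD (degree r) by apply: lt_ext_degree_le ltD_d'; apply: ltnW.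
      move/(mval_eq0 (pmval_module pm))/(peval_eq0 hr (leqnn _)): er => ->.
      exact: filt0.
    apply: (filt_lt (s := fun k => (0 < k)%N) _ (v := vr)); last exact: hNr.
    apply: lt_le_trans ltvq _.
    suff : above false (vq + c) (nu (ev r)) by rewrite er.
    rewrite rE pevalD pevalN; apply: (above_nuB Gord pm); first by rewrite efg.
    by rewrite pevalM eqPhi' /=.
  have : above true (vq + w) (term iota chi nu (Phi j) (q * Phi') k).
    rewrite -[q * Phi'](addrK r) -fgE.
    by apply: (filtD Gord pm (key j) (s := fun=> true) filt_fg); apply: filtN.
  by rewrite term_qPhi' /= ltxx.
have er : nu (ev r) = Some (vf + vg).
  have -> : r = f * g + - (q * Phi') by rewrite fgE addrC addKr.
  rewrite pevalD; apply: (nuD_eq Gord pm) => //.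
  by rewrite pevalN (nuN Gord pm) pevalM eqPhi'.
by rewrite -pevalM efg er eqPhi' vlt_above.
Qed.

(* Writing Psi = g Phi_i + c, the remainder of g Phi_i modulo Psi is - c, whence
   nu(c) < nu(Psi), and c is the constant digit of Psi. *)
Lemma key_polynomial_sub_nu_limit Psi : key_polynomial iota chi nu Psi ->
  (d < degree Psi)%N -> sub_nu_limit iota chi nu Phi Psi.
Proof.
move=> [mon _ hPsi keyPsi] dPsi; split=> // i.
have Psi0 := monic_neq0 mon.
have Phi0 : Phi i != 0 by rewrite -size_poly_gt0 szPhi.
set g := Psi %/ Phi i; set c := Psi %% Phi i.
have PsiE : Psi = g * Phi i + c := divp_eq _ _.
have sPsi : size Psi = (degree Psi).+1.
  by rewrite /degree prednK // size_poly_gt0.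
have g0 : g != 0 by rewrite divpN0 // szPhi sPsi ltnS ltnW.
have degg : (degree g + d = degree Psi)%N.
  have := size_divp Psi Phi0; rewrite -/g szPhi sPsi /degree => ->.
  by rewrite -/(degree Psi); lia.
have sc : (size c < size Psi)%N.
  by rewrite (@leq_trans (size (Phi i))) // ?ltn_modp // szPhi sPsi ltnS ltnW.
have dg : (degree g < degree Psi)%N by lia.
have := keyPsi (Phi i) g Phi0 g0.
rewrite degPhi addnC degg => /(_ dPsi dg hPsi).
(* Uniqueness of the euclidean division, applied to Phi_i g = Psi - c. *)
have [<- <-] : 1 = (Phi i * g) %/ Psi /\ - c = (Phi i * g) %% Psi.
  by apply: divp_modpP; rewrite ?size_polyN // mul1r mulrC {1}PsiE addrK.
rewrite /= pevalN (nuN Gord pm) // pevalC rmorph1 mul1r => -[_].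
case ec : (nu (ev c)) => [w|]; last by case: (nu (ev Psi)).
rewrite vlt_above; case eP : (nu (ev Psi)) => [u|]; last first.
  move/(mval_eq0 (pmval_module pm))/(peval_eq0 hPsi (leqnn _))/eqP: eP.
  by rewrite (negPf Psi0).
move=> /= wu; apply: (above_total Gord); apply/negP.
move=> /(above_nu_trunc Gord pm (key i)) /(_ 0).
rewrite (term0 iota chi nu (Phi i) Psi) ec /= => uw.
by have := lt_le_trans wu uw; rewrite ltxx.
Qed.

Lemma least_limit_degree_next : next_key_degree iota chi nu d d'.
Proof.
case: (least) => -[P hP eP] leastP; split=> [||e [Psi keyPsi <-] dPsi].
- by exists P => //; apply: limit_key_polynomial.
- exact: least_limit_degree_gt.
- by apply: leastP; apply: key_polynomial_sub_nu_limit.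
Qed.

(** The difference h - x has degree below [d'], hence is eventually dominant: its constant digit
    lies in the smaller module and has the same value, and subtracting that digit produces a larger
    distance. *)
Lemma least_limit_degree_immediate :
  no_greatest (values nu (Kpoly iota chi d.-1)) ->
  immediate_ext nu (Kpoly iota chi d'.-1) (Kpoly iota chi d.-1).
Proof.
move=> unbounded; have dd' := least_limit_degree_gt.
have modK j f : Kpoly iota chi d.-1 (ev (f %% Phi j)).
  exists (f %% Phi j) => //=.
  by rewrite prednK // -ltnS -(szPhi j) ltn_modp -size_poly_gt0 szPhi.
split=> [_ [f /= sf <-]|_ [h /= sh <-]].
  by exists f => //=; apply: leq_trans sf _; lia.
have deg_sub (x : {poly K}) : (size x <= d.-1.+1)%N -> (degree (h - x) < d')%N.
  move=> sx; rewrite /degree; have := size_polyD h (- x); rewrite size_polyN.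
  by move: (size _) (size h) (size x) sh sx => z y t; lia.
split=> [a [_ [_ [x /= sx <-] <-] ha]|[a [_ [_ [x /= sx <-] <-] ha] a_max]].
  have hd' := deg_sub x sx; have [N hN] := eventually_dominant hd'.
  exists (ev ((h - x) %% Phi N)); first exact: modK.
  rewrite (dominant_modp Gord pm (key N)) ?pevalD ?pevalN //.
    by apply: lt_ext_degree_le ltD_d'; apply: ltnW.
  exact: hN.
have hd' := deg_sub x sx; have [N hN] := eventually_dominant hd'.
have ltf : ltD (degree (h - x)) by apply: lt_ext_degree_le ltD_d'; apply: ltnW.
rewrite -pevalN -pevalD in ha.
have := dominant_sub Gord pm (key N) ltf (hN N (leqnn _)) ha.
set f := h - x in ha hd' ltf *; set y := f %% Phi N.
case eb : (nu _) => [b|] /= => [ab|].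
  suff : b <= a by move=> ba; have := lt_le_trans ab ba; rewrite ltxx.
  apply: a_max; exists (ev (f - y)) => //; exists (ev (x + y)).
    exists (x + y) => //=; rewrite (leq_trans (size_polyD _ _)) // geq_max sx.
    by rewrite prednK // -ltnS -(szPhi N) ltn_modp -size_poly_gt0 szPhi.
  by rewrite -pevalN -pevalD /f opprD addrA.
(* Here [f - y] vanishes at [chi], so [h = x + y] yields an element of the smaller module. All
   values of that module are then distances, and [a] would be the greatest of them. *)
move=> _; apply: unbounded; exists a.
  exists (ev y); first exact: modK.
  by rewrite (dominant_modp Gord pm (key N)) //; apply: hN.
move=> b [_ [z /= sz <-] hz]; apply: a_max; exists (ev z) => //.
have fy : f = y.
  apply/eqP; rewrite -subr_eq0; apply/eqP; apply: (peval_eq0 ltD_d').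
    rewrite (leq_trans _ (ltnW hd')) // /y {1}(divp_eq f (Phi N)) addrK.
    by rewrite /degree -!subn1 leq_sub2r // leq_divMp.
  by apply/(mval_eq0 (pmval_module pm)).
exists (ev (h - z)); last by rewrite -pevalN -pevalD opprB addrCA subrr addr0.
exists (h - z) => //=; have -> : h - z = x + y - z.
  by rewrite -fy /f addrCA subrr addr0.
rewrite (leq_trans (size_polyD _ _)) // geq_max size_polyN sz andbT.
rewrite (leq_trans (size_polyD _ _)) // geq_max sx.
by rewrite prednK // -ltnS -(szPhi N) ltn_modp -size_poly_gt0 szPhi.
Qed.

End LeastLimit.
End KeySequence.

Theorem theorem4p9 (K L : fieldType) (iota : {rmorphism K -> L}) (chi : L)
    (G : porderZmodType) (nu : L -> option G) (d : nat)
    (Phi : nat -> {poly K}) :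
  linearly_ordered_group G ->
  generated_by iota chi ->
  ~ range iota chi ->
  pm_valuation iota chi nu ->
  finite_rank (values nu (range iota)) ->
  (forall m, lt_ext_degree iota chi m ->
     no_greatest (values nu (Kpoly iota chi m))) ->
  immediate_key_degree iota chi nu d ->
  (forall i, key_polynomial iota chi nu (Phi i) /\ degree (Phi i) = d) ->
  (forall i j, (i <= j)%N ->
     vle (nu (peval iota chi (Phi i))) (nu (peval iota chi (Phi j)))) ->
  (forall a, dist_values nu (chi ^+ d) (Kpoly iota chi d.-1) a ->
     exists i, vle (Some a) (nu (peval iota chi (Phi i)))) ->
  [/\ (* 1) *)
      forall f : {poly K}, (degree f <= d)%N ->
        exists N, forall i, (N <= i)%N ->
          nu_trunc iota chi nu (Phi i) f = nu (peval iota chi f),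
      (* 2) *)
      forall d', least_limit_degree iota chi nu Phi d' ->
        (forall Phi', sub_nu_limit iota chi nu Phi Phi' -> degree Phi' = d' ->
           key_polynomial iota chi nu Phi') /\
        next_key_degree iota chi nu d d'
    & (* 3) *)
      forall d', least_limit_degree iota chi nu Phi d' ->
        immediate_ext nu (Kpoly iota chi d'.-1) (Kpoly iota chi d.-1)].
Proof.
move=> Gord _ _ pm _ unbounded [_ dists_unbounded] Phi_key Phi_incr Phi_cofinal.
split=> [|d' least|d' least].
- exact: (nu_trunc_eventually_eq Gord pm dists_unbounded Phi_key Phi_incr
            Phi_cofinal).
- have h := limit_key_polynomial Gord pm dists_unbounded Phi_key Phi_incr
    Phi_cofinal least.
  by split=> //; apply: (least_limit_degree_next Gord pm dists_unbounded
    Phi_key Phi_incr Phi_cofinal).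
- apply: (least_limit_degree_immediate Gord pm dists_unbounded Phi_key Phi_incr
    Phi_cofinal least).
  apply: unbounded; have [[_ _ ltD_Phi _] deg_Phi] := Phi_key 0.
  by apply: lt_ext_degree_le ltD_Phi; rewrite deg_Phi leq_pred.
Qed.
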